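(* For every $\beta:\mathsf{Brw}$ and every proposition $P$: $P$ is $\beta$-decidable if and only if $P$ is $\mathord{\uparrow}\beta$-decidable.
   Context: We work in homotopy type theory with propositional truncation. $\mathsf{Brw}$ is the type of Brouwer ordinals, defined as a set-truncated quotient inductive-inductive type simultaneously with a proposition-valued relation $\le$: point constructors $\mathsf{zero}$, $\mathsf{succ}$, and $\mathsf{lim}$ of strictly increasing sequences $f:\mathbb N\to\mathsf{Brw}$ ($\forall n.\,\mathsf{succ}(f_n)\le f_{n+1}$); a path constructor identifying limits of mutually simulating sequences; $\le$ is transitive, proposition-valued, with $\mathsf{zero}$ minimal, $\mathsf{succ}$ monotone, $\mathsf{lim}\,f$ the least upper bound of $f$. Addition is the usual ordinal addition on $\mathsf{Brw}$ and $\omega=\mathsf{lim}(\lambda n.\,n)$. The round-up function $\mathord{\uparrow}:\mathsf{Brw}\to\mathsf{Brw}$ is defined by $\mathord{\uparrow}\mathsf{zero}=\mathsf{zero}$, $\mathord{\uparrow}(\mathsf{succ}\,x)=x+\omega$, $\mathord{\uparrow}(\mathsf{lim}\,f)=\mathsf{lim}\,f$; its values are zero or limits. A proposition $P$ is $\alpha$-decidable if $\exists y:\mathsf{Brw}.\,(P\leftrightarrow \alpha\le y)$. *)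

(* Defs.v *)
From Stdlib Require Import ClassicalEpsilon FunctionalExtensionality
  PropExtensionality ProofIrrelevance.

Set Implicit Arguments.
Unset Strict Implicit.
Unset Printing Implicit Defensive.

(** Rocq has no quotient inductive-inductive types, so Brouwer ordinals are
    specified by the data that such a type declaration introduces: the
    constructors ([brw_algebra]) and the dependent eliminator with its
    computation rules ([brouwer]).  [Prop] plays the role of the universe of
    propositions and [exists] that of the truncated sum.  Statements quantify
    over an arbitrary [X : brouwer]; [brouwer_inhabited], at the end of the
    file, shows that one exists. *)

Definition is_prop (A : Type) : Prop := forall a b : A, a = b.
Definition is_set (A : Type) : Prop := forall a b : A, is_prop (a = b).

Record brw_algebra := BrwAlgebra {
  brw_car :> Type;
  brw_le : brw_car -> brw_car -> Prop;

  zero : brw_car;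
  succ : brw_car -> brw_car;
  lim : forall f : nat -> brw_car,
    (forall n, brw_le (succ (f n)) (f (S n))) -> brw_car;
  lim_bisim : forall f hf g hg,
    (forall k, exists n, brw_le (f k) (g n)) ->
    (forall k, exists n, brw_le (g k) (f n)) ->
    @lim f hf = @lim g hg;
  brw_is_set : is_set brw_car;

  le_zero : forall x, brw_le zero x;
  le_trans : forall x y z, brw_le x y -> brw_le y z -> brw_le x z;
  le_succ_mono : forall x y, brw_le x y -> brw_le (succ x) (succ y);
  le_cocone : forall x f hf n, brw_le x (f n) -> brw_le x (@lim f hf);
  le_limiting : forall f hf x,
    (forall n, brw_le (f n) x) -> brw_le (@lim f hf) x;
  le_is_prop : forall x y, is_prop (brw_le x y)
}.

Arguments zero {b}.
Arguments lim {b} f hf : rename.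
Arguments lim_bisim {b} f hf g hg _ _ : rename.

Declare Scope brw_scope.
Delimit Scope brw_scope with brw.
Notation "x <= y" := (brw_le x y) : brw_scope.
Local Open Scope brw_scope.

Definition increasing (X : brw_algebra) (f : nat -> X) : Prop :=
  forall n, succ (f n) <= f (S n).

Definition simulates (X : brw_algebra) (f g : nat -> X) : Prop :=
  forall k, exists n, f k <= g n.

(** Motives and methods of the dependent eliminator: one field for every
    constructor of [brw_algebra], including the path and truncation
    constructors. *)
Record displayed (X : brw_algebra) := Displayed {
  d_car :> X -> Type;
  d_le : forall x y, d_car x -> d_car y -> x <= y -> Prop;

  d_zero : d_car zero;
  d_succ : forall x, d_car x -> d_car (succ x);
  d_lim : forall (f : nat -> X) (hf : increasing f) (a : forall n, d_car (f n)),
    (forall n, d_le (d_succ (a n)) (a (S n)) (hf n)) -> d_car (lim f hf);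
  d_bisim : forall f (hf : increasing f) a ha g (hg : increasing g) b hb
    (fg : simulates f g) (gf : simulates g f),
    (forall k, exists n (h : f k <= g n), d_le (a k) (b n) h) ->
    (forall k, exists n (h : g k <= f n), d_le (b k) (a n) h) ->
    eq_rect (lim f hf) d_car (@d_lim f hf a ha) (lim g hg)
      (lim_bisim f hf g hg fg gf) = @d_lim g hg b hb;
  d_is_set : forall x, is_set (d_car x);

  d_le_zero : forall x (a : d_car x), d_le d_zero a (le_zero x);
  d_le_trans : forall x y z (p : x <= y) (q : y <= z) a b c,
    d_le a b p -> d_le b c q -> d_le a c (le_trans p q);
  d_le_succ_mono : forall x y (p : x <= y) a b,
    d_le a b p -> d_le (d_succ a) (d_succ b) (le_succ_mono p);
  d_le_cocone : forall x (a : d_car x) f (hf : increasing f) b hb n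
    (p : x <= f n),
    d_le a (b n) p -> d_le a (@d_lim f hf b hb) (le_cocone hf p);
  d_le_limiting : forall f (hf : increasing f) a ha x (b : d_car x)
    (p : forall n, f n <= x),
    (forall n, d_le (a n) b (p n)) ->
    d_le (@d_lim f hf a ha) b (le_limiting hf p);
  d_le_is_prop : forall x y (a : d_car x) (b : d_car y) p, is_prop (d_le a b p)
}.

(** The functions produced by the eliminator, with the computation rules for
    the point constructors. *)
Record elimination (X : brw_algebra) (D : displayed X) := Elimination {
  elim :> forall x, D x;
  elim_le : forall x y (p : x <= y), d_le (elim x) (elim y) p;

  elim_zero : elim zero = d_zero D;
  elim_succ : forall x, elim (succ x) = d_succ (elim x);
  elim_lim : forall f (hf : increasing f),
    elim (lim f hf) =
    d_lim (fun n => eq_rect (elim (succ (f n)))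
                      (fun a => d_le a (elim (f (S n))) (hf n))
                      (elim_le (hf n)) _ (elim_succ (f n)))
}.

Record brouwer := Brouwer {
  brw_alg :> brw_algebra;
  brw_elim : forall D : displayed brw_alg, elimination D
}.

Lemma is_prop_is_set (A : Type) : is_prop A -> is_set A.
Proof.
intros hA a b.
assert (E : forall c (r : a = c), r = eq_trans (eq_sym (hA a a)) (hA a c)).
{ intros c r; destruct r; destruct (hA a a); reflexivity. }
intros p q; rewrite (E b p), (E b q); reflexivity.
Qed.

Lemma sig_is_set (A : Type) (P : A -> Prop) :
  is_set A -> (forall a, is_prop (P a)) -> is_set {a | P a}.
Proof.
intros hA hP u v.
assert (E : forall w (r : u = w),
  r = eq_sig u w (f_equal (@proj1_sig A P) r) (hP _ _ _)).
{ intros w r; destruct r; destruct u as [a p]; simpl.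
  rewrite (is_prop_is_set (hP a) (hP a p p) eq_refl); reflexivity. }
intros p q; rewrite (E v p), (E v q).
rewrite (hA _ _ (f_equal (@proj1_sig A P) p) (f_equal (@proj1_sig A P) q)).
reflexivity.
Qed.

Section Operations.
Variable X : brouwer.

Lemma brw_ind (P : X -> Prop) :
  (forall x, is_prop (P x)) ->
  P zero -> (forall x, P x -> P (succ x)) ->
  (forall f (hf : increasing f), (forall n, P (f n)) -> P (lim f hf)) ->
  forall x, P x.
Proof.
intros hP h0 hS hL.
unshelve epose (D := {|
  d_car := P : X -> Type;
  d_le := fun _ _ _ _ _ => True;
  d_zero := h0;
  d_succ := hS;
  d_lim := fun f hf a _ => hL f hf a
|} : displayed X); try (intros; exact I).
- intros; apply hP.
- intros x; apply is_prop_is_set, hP.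
- intros _ _ _ _ _ [] []; reflexivity.
- exact (fun x => brw_elim D x).
Qed.

Lemma le_refl (x : X) : x <= x.
Proof.
revert x; apply brw_ind.
- intro; apply le_is_prop.
- apply le_zero.
- intros x; apply le_succ_mono.
- intros f hf h; apply le_limiting; intro n; apply (le_cocone hf (h n)).
Qed.

Lemma le_succ (x : X) : x <= succ x.
Proof.
revert x; apply brw_ind.
- intro; apply le_is_prop.
- apply le_zero.
- intros x; apply le_succ_mono.
- intros f hf h; apply le_limiting; intro n.
  apply (le_trans (h n)), le_succ_mono, (le_cocone hf (le_refl (f n))).
Qed.

(* Addition [x + y] is defined by recursion on [y], mutually with its
   monotonicity in [y], which makes [fun n => x + f n] increasing in the limit
   case, and with [x <= x + y], which the clause for [le_zero] requires. *)
Definition add_displayed (x : X) : displayed X.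
Proof.
refine {|
  d_car := fun _ => {a : X | x <= a};
  d_le := fun _ _ a b _ => proj1_sig a <= proj1_sig b;
  d_zero := exist _ x (le_refl x);
  d_succ := fun _ a =>
    exist _ (succ (proj1_sig a)) (le_trans (proj2_sig a) (le_succ _));
  d_lim := fun _ _ a ha =>
    exist _ (lim (fun n => proj1_sig (a n)) ha)
      (le_cocone (n := 0) ha (proj2_sig (a 0)))
|}.
- intros f hf a ha g hg b hb fg gf sab sba.
  rewrite rew_const; apply eq_sig_hprop; [intros ?; apply le_is_prop|].
  apply lim_bisim; intro k.
  + destruct (sab k) as [n [_ h]]; exists n; exact h.
  + destruct (sba k) as [n [_ h]]; exists n; exact h.
- intros _; apply sig_is_set; [apply brw_is_set|intro; apply le_is_prop].
- intros _ a; exact (proj2_sig a).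
- intros y1 y2 y3 _ _ a b c; apply le_trans.
- intros y1 y2 _ a b; apply le_succ_mono.
- intros y a f _ b hb n _.
  exact (@le_cocone X _ (fun m => proj1_sig (b m)) hb n).
- intros f _ a ha y b _.
  exact (@le_limiting X (fun m => proj1_sig (a m)) ha _).
- intros; apply le_is_prop.
Defined.

Definition add (x y : X) : X := proj1_sig (brw_elim (add_displayed x) y).

Definition of_nat (n : nat) : X := Nat.iter n (@succ X) zero.

Definition omega : X := lim of_nat (fun n => le_refl (succ (of_nat n))).

Definition roundup_displayed : displayed X.
Proof.
refine {|
  d_car := fun _ => X;
  d_le := fun _ _ _ _ _ => True;
  d_zero := zero;
  d_succ := fun x _ => add x omega;
  d_lim := fun f hf _ _ => lim f hf
|}; try (intros; exact I).
- intros; rewrite rew_const; apply lim_bisim; assumption.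
- intros _; apply brw_is_set.
- intros _ _ _ _ _ [] []; reflexivity.
Defined.

Definition roundup : X -> X := brw_elim roundup_displayed.

Definition ord_decidable (alpha : X) (P : Prop) : Prop :=
  exists y : X, P <-> alpha <= y.

(** The recursion equations of the operations above. *)

Lemma lim_eq (f g : nat -> X) (hf : increasing f) (hg : increasing g) :
  (forall n, f n = g n) -> lim f hf = lim g hg.
Proof.
intro fg; apply lim_bisim; intro k; exists k; rewrite fg; apply le_refl.
Qed.

Lemma add_zero x : add x zero = x.
Proof. unfold add; rewrite elim_zero; reflexivity. Qed.

Lemma add_succ x y : add x (succ y) = succ (add x y).
Proof. unfold add; rewrite elim_succ; reflexivity. Qed.

Lemma add_le_mono x y z : y <= z -> add x y <= add x z.
Proof. exact (elim_le (brw_elim (add_displayed x)) (y := z)). Qed.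

Lemma add_increasing x f : increasing f -> increasing (fun n => add x (f n)).
Proof. intros hf n; rewrite <- add_succ; apply add_le_mono, hf. Qed.

Lemma add_lim x f (hf : increasing f) :
  add x (lim f hf) = lim (fun n => add x (f n)) (add_increasing x hf).
Proof. unfold add at 1; rewrite elim_lim; apply lim_eq; reflexivity. Qed.

Lemma roundup_zero : roundup zero = zero.
Proof. exact (elim_zero (brw_elim roundup_displayed)). Qed.

Lemma roundup_succ x : roundup (succ x) = add x omega.
Proof. exact (elim_succ (brw_elim roundup_displayed) x). Qed.

Lemma roundup_lim f (hf : increasing f) : roundup (lim f hf) = lim f hf.
Proof. exact (elim_lim (brw_elim roundup_displayed) hf). Qed.

End Operations.

(** ** Existence *)

(* Raw trees up to mutual inequality, each class being represented by a chosen
   tree; this needs classical axioms, which nothing above depends on. *)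
Module Model.

Local Unset Implicit Arguments.

Inductive tree := tz | ts (t : tree) | tl (f : nat -> tree).

Inductive tle : tree -> tree -> Prop :=
| tle_z t : tle tz t
| tle_s s t : tle s t -> tle (ts s) (ts t)
| tle_co s f n : tle s (f n) -> tle s (tl f)
| tle_l f t : (forall n, tle (f n) t) -> tle (tl f) t.

Fixpoint wf (t : tree) : Prop :=
  match t with
  | tz => True
  | ts t => wf t
  | tl f => (forall n, wf (f n)) /\ (forall n, tle (ts (f n)) (f (S n)))
  end.

Lemma tle_refl t : tle t t.
Proof.
induction t as [|t IH|f IH]; constructor; auto.
intro n; exact (tle_co _ _ _ (IH n)).
Qed.

Lemma tle_trans s t u : tle s t -> tle t u -> tle s u.
Proof.
intro st; revert u; induction st as [t|s t st IH|s f n st IH|f t ft IH];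
  intros u tu.
- constructor.
- remember (ts t) as t' eqn:E; induction tu; try discriminate E.
  + injection E as ->; constructor; auto.
  + apply tle_co with n; auto.
- remember (tl f) as t' eqn:E; induction tu; try discriminate E.
  + apply tle_co with n0; auto.
  + injection E as ->; auto.
- constructor; auto.
Qed.

Lemma tle_succ t : tle t (ts t).
Proof.
induction t as [|t IH|f IH]; constructor; auto.
intro n; apply (tle_trans _ _ _ (IH n)); constructor.
exact (tle_co _ _ _ (tle_refl _)).
Qed.

Lemma tle_lim_inv f t : tle (tl f) t -> forall n, tle (f n) t.
Proof.
intros ft n; apply (fun h => tle_trans _ _ _ h ft).
exact (tle_co _ _ _ (tle_refl _)).
Qed.

Lemma tle_succ_lim_inv s f : tle (ts s) (tl f) -> exists n, tle (ts s) (f n).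
Proof. intro h; inversion h; subst; eauto. Qed.

Lemma tle_sim f g : wf (tl f) -> tle (tl f) (tl g) ->
  forall k, exists n, tle (f k) (g n).
Proof.
intros [_ hf] fg k.
destruct (tle_succ_lim_inv _ _ (tle_trans _ _ _ (hf k) (tle_lim_inv _ _ fg _)))
  as [n h].
exists n; exact (tle_trans _ _ _ (tle_succ _) h).
Qed.

Lemma tle_lim_succ_inv f t : wf (tl f) -> tle (tl f) (ts t) -> tle (tl f) t.
Proof.
intros [_ hf] h; constructor; intro n.
pose proof (tle_trans _ _ _ (hf n) (tle_lim_inv _ _ h _)) as h'.
inversion h'; assumption.
Qed.

Definition nf (t : tree) : tree :=
  epsilon (inhabits tz) (fun s => wf s /\ tle s t /\ tle t s).

Lemma nf_spec t : wf t -> wf (nf t) /\ tle (nf t) t /\ tle t (nf t).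
Proof.
intro h; unfold nf; apply epsilon_spec.
exists t; auto using tle_refl.
Qed.

Lemma nf_eq s t : tle s t -> tle t s -> nf s = nf t.
Proof.
intros st ts; unfold nf; f_equal; apply functional_extensionality; intro u.
apply propositional_extensionality; split; intros (h & a & b);
  eauto 6 using tle_trans.
Qed.

Definition car := {t | wf t /\ nf t = t}.
Definition repr (x : car) : tree := proj1_sig x.
Lemma repr_wf x : wf (repr x). Proof. exact (proj1 (proj2_sig x)). Qed.

Definition mk (t : tree) (h : wf t) : car.
Proof.
exists (nf t); destruct (nf_spec t h) as (a & b & c); split; [exact a|].
apply nf_eq; assumption.
Defined.

Definition le (x y : car) : Prop := tle (repr x) (repr y).

Lemma le_antisym x y : le x y -> le y x -> x = y.
Proof.
intros a b; apply eq_sig_hprop; [intros; apply proof_irrelevance|].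
rewrite <- (proj2 (proj2_sig x)), <- (proj2 (proj2_sig y)).
apply nf_eq; assumption.
Qed.

Lemma mk_le t h : tle (repr (mk t h)) t.
Proof. apply (nf_spec t h). Qed.

Lemma mk_ge t h : tle t (repr (mk t h)).
Proof. apply (nf_spec t h). Qed.

Definition zero : car := mk tz I.
Definition succ (x : car) : car := mk (ts (repr x)) (repr_wf x).

Lemma lim_wf (f : nat -> car) :
  (forall n, le (succ (f n)) (f (S n))) -> wf (tl (fun n => repr (f n))).
Proof.
intro hf; split; intro n; [apply repr_wf|].
exact (tle_trans _ _ _ (mk_ge _ _) (hf n)).
Qed.

Definition lim (f : nat -> car) hf : car := mk _ (lim_wf f hf).

Lemma succ_le x y : le (succ x) (succ y) -> le x y.
Proof.
intro h.
pose proof (tle_trans _ _ _ (mk_ge _ _) (tle_trans _ _ _ h (mk_le _ _))) as h'.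
inversion h'; assumption.
Qed.

Lemma succ_zero x : ~ le (succ x) zero.
Proof.
intro h.
pose proof (tle_trans _ _ _ (mk_ge _ _) (tle_trans _ _ _ h (mk_le _ _))) as h'.
inversion h'.
Qed.

Lemma succ_le_lim x f hf : le (succ x) (lim f hf) -> exists n, le (succ x) (f n).
Proof.
intro h.
destruct (tle_succ_lim_inv _ _
  (tle_trans _ _ _ (mk_ge _ _) (tle_trans _ _ _ h (mk_le _ _)))) as [n h'].
exists n; exact (tle_trans _ _ _ (mk_le _ _) h').
Qed.

Lemma lim_ub f hf n : le (f n) (lim f hf).
Proof.
apply (fun h => tle_trans _ _ _ h (mk_ge _ (lim_wf f hf))).
exact (tle_co _ (fun n => repr (f n)) n (tle_refl _)).
Qed.

Lemma lim_lub f hf x : (forall n, le (f n) x) -> le (lim f hf) x.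
Proof.
intro h; apply (tle_trans _ _ _ (mk_le _ _)); constructor; exact h.
Qed.

Lemma lim_sim f hf g hg : le (lim f hf) (lim g hg) ->
  forall k, exists n, le (f k) (g n).
Proof.
intro h; apply tle_sim; [exact (lim_wf f hf)|].
exact (tle_trans _ _ _ (mk_ge _ _) (tle_trans _ _ _ h (mk_le _ _))).
Qed.

Lemma lim_le_succ f hf x : le (lim f hf) (succ x) -> le (lim f hf) x.
Proof.
intro h; apply (tle_trans _ _ _ (mk_le _ _)).
apply tle_lim_succ_inv; [exact (lim_wf f hf)|].
exact (tle_trans _ _ _ (mk_ge _ _) (tle_trans _ _ _ h (mk_le _ _))).
Qed.

Lemma lim_not_le_zero f hf : ~ le (lim f hf) zero.
Proof.
intro h; apply (succ_zero (f 0)).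
exact (tle_trans _ _ _ (hf 0) (tle_trans _ _ _ (lim_ub f hf 1) h)).
Qed.

Lemma car_ind (P : car -> Prop) :
  P zero -> (forall x, P x -> P (succ x)) ->
  (forall f hf, (forall n, P (f n)) -> P (lim f hf)) -> forall x, P x.
Proof.
intros h0 hS hL.
assert (H : forall t (h : wf t), P (mk t h)).
{ induction t as [|t IH|f IH]; intro h.
  - replace (mk tz h) with zero; [exact h0|].
    apply le_antisym; exact (tle_trans _ _ _ (mk_le _ _) (mk_ge _ _)).
  - replace (mk (ts t) h) with (succ (mk t h)); [auto|].
    apply le_antisym; apply (tle_trans _ _ _ (mk_le _ _));
      (eapply tle_trans; [|apply mk_ge]); constructor; auto using mk_le, mk_ge.
  - destruct h as [hw hi].
    assert (hf : forall n, le (succ (mk (f n) (hw n))) (mk (f (S n)) (hw (S n)))).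
    { intro n; apply (tle_trans _ _ _ (mk_le _ _)).
      eapply tle_trans; [|apply mk_ge]; eapply tle_trans; [|apply hi].
      constructor; apply mk_le. }
    replace (mk (tl f) (conj hw hi)) with (lim (fun n => mk (f n) (hw n)) hf);
      [auto|].
    apply le_antisym; apply (tle_trans _ _ _ (mk_le _ _));
      (eapply tle_trans; [|apply mk_ge]); constructor; intro n.
    + exact (tle_co _ _ _ (mk_le _ _)).
    + exact (tle_co _ (fun n => repr (mk (f n) (hw n))) n (mk_ge _ _)). }
intro x; replace x with (mk (repr x) (repr_wf x)); [apply H|].
apply le_antisym; [apply mk_le|apply mk_ge].
Qed.

Definition alg : brw_algebra.
Proof.
refine (@BrwAlgebra car le zero succ lim _ _ _ _ _ _ _ _).
- intros f hf g hg fg gf; apply le_antisym; apply lim_lub; intro k.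
  + destruct (fg k) as [n h]; exact (tle_trans _ _ _ h (lim_ub _ _ _)).
  + destruct (gf k) as [n h]; exact (tle_trans _ _ _ h (lim_ub _ _ _)).
- intros x y p q; apply proof_irrelevance.
- intro x; exact (tle_trans _ _ _ (mk_le _ _) (tle_z _)).
- intros x y z; apply tle_trans.
- intros x y h; apply (tle_trans _ _ _ (mk_le _ _)).
  eapply tle_trans; [|apply mk_ge]; constructor; exact h.
- intros x f hf n h; exact (tle_trans _ _ _ h (lim_ub _ _ _)).
- intros f hf x; apply lim_lub.
- intros x y p q; apply proof_irrelevance.
Defined.

Section Elim.
Variable D : displayed alg.

Inductive graph : forall x : alg, D x -> Prop :=
| g_zero : graph _ (d_zero D)
| g_succ x a : graph x a -> graph _ (d_succ a)
| g_lim f (hf : increasing f) (a : forall n, D (f n)) ha :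
    (forall n, graph _ (a n)) -> graph _ (@d_lim _ D f hf a ha).
Arguments graph {x} a.

Lemma graph_le x a y b (h : @brw_le alg x y) :
  graph a -> graph b -> d_le a b h.
Proof.
intro ga; revert y b h.
induction ga as [|x a ga IH|f hf a ha ga IH]; intros y b h gb.
- rewrite (proof_irrelevance _ h (le_zero y)); apply d_le_zero.
- induction gb as [|y b gb IHb|g hg b hb gb IHb].
  + destruct (succ_zero _ h).
  + rewrite (proof_irrelevance _ h (le_succ_mono (b := alg) (succ_le _ _ h))).
    apply d_le_succ_mono, IH, gb.
  + destruct (succ_le_lim _ _ _ h) as [n h'].
    rewrite (proof_irrelevance _ h (le_cocone (b := alg) hg h')).
    apply d_le_cocone, IHb.
- assert (h' : forall n, @brw_le alg (f n) y).
  { intro n; exact (tle_trans _ _ _ (lim_ub f hf n) h). }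
  rewrite (proof_irrelevance _ h (le_limiting hf h')).
  apply d_le_limiting; intro n; apply IH, gb.
Qed.

Lemma eq_rect_irr (A : Type) (P : A -> Type) x (a : P x) (e : x = x) :
  eq_rect x P a x e = a.
Proof. rewrite (proof_irrelevance _ e eq_refl); reflexivity. Qed.

Lemma le_of_eq (x y : car) : x = y -> le x y.
Proof. intros []; apply tle_refl. Qed.

Lemma succ_inj x y : succ x = succ y -> x = y.
Proof.
intro e; apply le_antisym; apply succ_le; rewrite e; apply tle_refl.
Qed.

Lemma lim_not_succ f hf x : lim f hf <> succ x.
Proof.
intro e.
assert (h : le (succ x) x).
{ rewrite <- e; apply lim_le_succ; rewrite e; apply tle_refl. }
clear e f hf; revert x h; apply (car_ind (fun x => ~ le (succ x) x)).
- apply (succ_zero zero).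
- intros x IH h; exact (IH (succ_le _ _ h)).
- intros f hf IH h.
  destruct (succ_le_lim _ _ _ h) as [n h']; apply (IH n).
  apply (fun p => tle_trans _ _ _ p h').
  apply (tle_trans _ _ _ (mk_le _ _)); eapply tle_trans; [|apply mk_ge].
  constructor; apply lim_ub.
Qed.

Lemma graph_fun x a : graph a ->
  forall y b, graph b -> forall e : x = y, eq_rect x D a y e = b.
Proof.
induction 1 as [|x a ga IH|f hf a ha ga IH]; intros y b gb e;
  destruct gb as [|y b gb|g hg b hb gb].
- apply eq_rect_irr.
- destruct (succ_zero y); exact (le_of_eq _ _ (eq_sym e)).
- destruct (lim_not_le_zero g hg); exact (le_of_eq _ _ (eq_sym e)).
- destruct (succ_zero x); exact (le_of_eq _ _ e).
- destruct (succ_inj x y e); rewrite eq_rect_irr; f_equal.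
  exact (IH _ _ gb eq_refl).
- destruct (lim_not_succ g hg x); symmetry; exact e.
- destruct (lim_not_le_zero f hf); exact (le_of_eq _ _ e).
- destruct (lim_not_succ f hf y); exact e.
- pose proof (lim_sim f hf g hg (le_of_eq _ _ e) : @simulates alg f g) as fg.
  pose proof (lim_sim g hg f hf (le_of_eq _ _ (eq_sym e))
    : @simulates alg g f) as gf.
  rewrite (proof_irrelevance _ e (lim_bisim f hf g hg fg gf)).
  apply d_bisim; intro k.
  + destruct (fg k) as [n h]; exists n, h; apply graph_le; auto.
  + destruct (gf k) as [n h]; exists n, h; apply graph_le; auto.
Qed.

Lemma graph_ex (x : alg) : exists a : D x, graph a.
Proof.
revert x; apply (car_ind (fun x => exists a : D x, graph a)).
- exists (d_zero D); constructor.
- intros x [a ga]; exists (d_succ a); constructor; exact ga.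
- intros f hf h.
  pose (a n := proj1_sig (constructive_indefinite_description _ (h n))).
  assert (ga : forall n, graph (a n)).
  { intro n; exact (proj2_sig (constructive_indefinite_description _ (h n))). }
  unshelve eexists (@d_lim alg D f hf a _).
  + intro n; apply graph_le; [constructor|]; apply ga.
  + constructor; exact ga.
Qed.

Definition rec (x : alg) : D x :=
  proj1_sig (constructive_indefinite_description _ (graph_ex x)).

Lemma rec_graph x : graph (rec x).
Proof. exact (proj2_sig (constructive_indefinite_description _ _)). Qed.

Lemma rec_eq (x : alg) (a : D x) : graph a -> rec x = a.
Proof. intro ga; exact (graph_fun _ _ (rec_graph x) _ _ ga eq_refl). Qed.

Definition rec_elimination : elimination D.
Proof.
refine {|
  elim := rec;
  elim_le := fun x y h => graph_le _ _ _ _ h (rec_graph x) (rec_graph y);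
  elim_zero := rec_eq _ _ g_zero;
  elim_succ := fun x => rec_eq _ _ (g_succ _ _ (rec_graph x))
|}.
intros f hf; apply rec_eq; constructor; intro n; apply rec_graph.
Defined.

End Elim.

End Model.

Theorem brouwer_inhabited : inhabited brouwer.
Proof. exact (inhabits (Brouwer Model.rec_elimination)). Qed.

(* Main.v *)
From Stdlib Require Import Lia PropExtensionality.
Require Import Defs.

(** Every ordinal is [k + n] with [k] zero or a limit and [n] finite.  If [m]
    is zero or a limit, then [k + n < m] already forces [k + n + omega <= m],
    and [k <= m + n] forces [k <= m].  Let [beta = k + n + 1], so that the
    round-up is [k + n + omega].  If [P <-> k + n + omega <= m + i], then also
    [P <-> beta <= m].  If [P <-> beta <= m + i], then [P <-> k < m] when
    [i <= n], and [P <-> k <= m] otherwise, so [m], respectively [m + omega],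
    witnesses [roundup beta]-decidability. *)

Set Implicit Arguments.
Unset Strict Implicit.
Unset Printing Implicit Defensive.

Local Open Scope brw_scope.
Local Notation "x ⊕ n" := (add x (of_nat _ n)) (at level 50).

Section Brouwer.
Variable X : brouwer.
Implicit Types (x y z k m : X) (f : nat -> X) (n i : nat).

(* Encode-decode: [succ_le_code x y] computes [succ x <= y] by recursion on
   [y], propositional extensionality standing in for univalence. *)
Definition succ_le_code_displayed x : displayed X.
Proof.
refine {|
  d_car := fun _ => Prop;
  d_le := fun _ _ (a b : Prop) _ => a -> b;
  d_zero := False;
  d_succ := fun y _ => x <= y;
  d_lim := fun _ _ a _ => exists n, a n
|}.
- intros f hf a ha g hg b hb fg gf sab sba; rewrite rew_const.
  apply propositional_extensionality; split; intros [n c].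
  + destruct (sab n) as [i [_ h]]; exists i; auto.
  + destruct (sba n) as [i [_ h]]; exists i; auto.
- intros _ a b p q; apply proof_irrelevance.
- intros _ a [].
- auto.
- intros y z p _ _ _ h; exact (le_trans h p).
- intros y a f _ b _ n _ h c; exists n; auto.
- intros f _ a _ y b _ h [n c]; exact (h n c).
- intros ? ? ? ? ? p q; apply proof_irrelevance.
Defined.

Definition succ_le_code x y : Prop := brw_elim (succ_le_code_displayed x) y.

(** Monotonicity of the eliminator carries the code of [succ x <= succ x], which computes to
    [x <= x], along [h]. *)
Lemma succ_le_encode x y : succ x <= y -> succ_le_code x y.
Proof.
intro h; apply (elim_le (brw_elim (succ_le_code_displayed x)) h).
rewrite elim_succ; apply le_refl.
Qed.

Lemma succ_le_decode x y : succ_le_code x y -> succ x <= y.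
Proof.
revert y; unfold succ_le_code; refine (brw_ind _ _ _ _).
- intros ? p q; apply proof_irrelevance.
- rewrite elim_zero; intros [].
- intros y _; rewrite elim_succ; apply le_succ_mono.
- intros f hf IH; rewrite elim_lim; intros [n h].
  exact (le_cocone hf (IH n h)).
Qed.

Lemma not_succ_le_zero x : ~ succ x <= zero.
Proof.
intro h; apply succ_le_encode in h; unfold succ_le_code in h.
rewrite elim_zero in h; exact h.
Qed.

Lemma succ_le_succ x y : succ x <= succ y <-> x <= y.
Proof.
split; [|apply le_succ_mono].
intro h; apply succ_le_encode in h; unfold succ_le_code in h.
rewrite elim_succ in h; exact h.
Qed.

Lemma succ_le_lim x f (hf : increasing f) :
  succ x <= lim f hf -> exists n, succ x <= f n.
Proof.
intro h; apply succ_le_encode in h; unfold succ_le_code in h.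
rewrite elim_lim in h; destruct h as [n h].
exists n; apply succ_le_decode, h.
Qed.

Lemma le_lim f (hf : increasing f) n : f n <= lim f hf.
Proof. exact (le_cocone hf (le_refl (f n))). Qed.

Lemma add_nat_S x n : x ⊕ S n = succ (x ⊕ n).
Proof. exact (add_succ x (of_nat X n)). Qed.

Lemma add_nat_0 x : x ⊕ 0 = x.
Proof. exact (add_zero x). Qed.

Lemma add_nat_le_add_nat x y n i : x ⊕ (n + i) <= y ⊕ i <-> x ⊕ n <= y.
Proof.
induction i as [|i IH]; [rewrite <- plus_n_O, add_nat_0; reflexivity|].
rewrite <- plus_n_Sm, !add_nat_S, succ_le_succ; exact IH.
Qed.

Lemma le_add_nat_le_add_nat x y n i : x ⊕ i <= y ⊕ (n + i) <-> x <= y ⊕ n.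
Proof.
induction i as [|i IH]; [rewrite <- plus_n_O, add_nat_0; reflexivity|].
rewrite <- plus_n_Sm, !add_nat_S, succ_le_succ; exact IH.
Qed.

Lemma le_add_nat x n : x <= x ⊕ n.
Proof.
induction n as [|n IH]; [rewrite add_nat_0; apply le_refl|].
rewrite add_nat_S; exact (le_trans IH (le_succ _)).
Qed.

Lemma add_omega_le x y : add x (omega X) <= y <-> forall n, x ⊕ n <= y.
Proof.
split.
- intros h n; refine (le_trans _ h); apply add_le_mono.
  exact (le_lim (f := of_nat X) _ n).
- intro h; unfold omega; rewrite add_lim; apply le_limiting, h.
Qed.

Definition zero_or_limit x : Prop :=
  x = zero \/ exists f (hf : increasing f), x = lim f hf.

Lemma add_omega_zero_or_limit x : zero_or_limit (add x (omega X)).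
Proof. right; unfold omega; rewrite add_lim; eauto. Qed.

Lemma zero_or_limit_add_nat x :
  exists k n, zero_or_limit k /\ x = k ⊕ n.
Proof.
revert x; refine (brw_ind _ _ _ _).
- intros ? p q; apply proof_irrelevance.
- exists zero, 0; rewrite add_nat_0; split; [left|]; reflexivity.
- intros x (k & n & hk & ->); exists k, (S n).
  rewrite add_nat_S; auto.
- intros f hf _; exists (lim f hf), 0; rewrite add_nat_0.
  split; [right; eauto|reflexivity].
Qed.

Lemma roundup_zero_or_limit k : zero_or_limit k -> roundup k = k.
Proof.
intros [->|(f & hf & ->)]; [apply roundup_zero|apply roundup_lim].
Qed.

(** For a limit, [succ (f n) <= f (S n) <= lim f hf <= succ x], and cancelling [succ] bounds every
    [f n] by [x]. *)
Lemma zero_or_limit_le_succ k x : zero_or_limit k -> k <= succ x -> k <= x.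
Proof.
intros [->|(f & hf & ->)] h; [apply le_zero|].
apply le_limiting; intro n; apply succ_le_succ.
exact (le_trans (hf n) (le_trans (le_lim hf (S n)) h)).
Qed.

Lemma zero_or_limit_le_add_nat k x n :
  zero_or_limit k -> k <= x ⊕ n <-> k <= x.
Proof.
intro hk; split; [|intro h; exact (le_trans h (le_add_nat x n))].
induction n as [|n IH]; [rewrite add_nat_0; auto|].
rewrite add_nat_S; intro h; apply IH, zero_or_limit_le_succ; assumption.
Qed.

(** A successor below a limit lies below some [f n], and the strict increase from [f n] to [f (S n)]
    makes room for one more. *)
Lemma succ_succ_le_zero_or_limit m x :
  zero_or_limit m -> succ x <= m -> succ (succ x) <= m.
Proof.
intros [->|(f & hf & ->)] h; [destruct (not_succ_le_zero h)|].
destruct (succ_le_lim h) as [n hn].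
exact (le_trans (le_succ_mono hn) (le_trans (hf n) (le_lim hf (S n)))).
Qed.

(** Iterates the previous lemma. The index is [S n] because at index 0 the left side would allow
    [x = m]. *)
Lemma add_nat_le_zero_or_limit m x n :
  zero_or_limit m -> x ⊕ S n <= m <-> succ x <= m.
Proof.
intro hm; split.
- intro h; refine (le_trans _ h).
  rewrite add_nat_S; apply le_succ_mono, le_add_nat.
- intro h; induction n as [|n IH]; rewrite !add_nat_S.
  { rewrite add_nat_0; exact h. }
  apply succ_succ_le_zero_or_limit; [exact hm|].
  rewrite <- add_nat_S; exact IH.
Qed.

Lemma add_omega_le_zero_or_limit m x :
  zero_or_limit m -> add x (omega X) <= m <-> succ x <= m.
Proof.
intro hm; rewrite add_omega_le; split.
- intro h; specialize (h 1); rewrite add_nat_S, add_nat_0 in h; exact h.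
(* Passing to index [S n] covers [n = 0] as well. *)
- intros h n; refine (le_trans _ (proj2 (add_nat_le_zero_or_limit x n hm) h)).
  rewrite add_nat_S; apply le_succ.
Qed.

(** Some [x ⊕ n] already lies above [succ k], and [k], being zero or a limit, stays below [x] when
    [n] is dropped. *)
Lemma succ_le_add_omega k x :
  zero_or_limit k -> succ k <= add x (omega X) <-> k <= x.
Proof.
intro hk; unfold omega; rewrite add_lim; split.
- intro h; destruct (succ_le_lim h) as [n hn].
  apply (zero_or_limit_le_add_nat x n hk).
  exact (le_trans (le_succ k) hn).
- intro h; eapply le_cocone with (n := 1).
  rewrite add_nat_S, add_nat_0; apply le_succ_mono, h.
Qed.

Lemma ord_decidable_roundup_add_nat k n (P : Prop) : zero_or_limit k ->
  ord_decidable (k ⊕ S n) P <-> ord_decidable (add (k ⊕ n) (omega X)) P.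
Proof.
intro hk; split; intros [y hy];
  destruct (zero_or_limit_add_nat y) as (m & i & hm & ->).
- destruct (PeanoNat.Nat.le_gt_cases i n) as [hi|hi].
  (* Cancelling [i] leaves the positive finite part [S (n - i)], so both sides reduce to
     [succ k <= m]. *)
  + exists m; rewrite hy, add_omega_le_zero_or_limit by exact hm.
    replace (S n) with (S (n - i) + i) by lia.
    rewrite add_nat_le_add_nat, <- add_nat_S.
    rewrite !add_nat_le_zero_or_limit by exact hm; reflexivity.
  (* The witness [m] would only express [k < m]; with [m + omega] the right side reduces to
     [k < m + omega], that is, [k <= m]. *)
  + exists (add m (omega X)); rewrite hy.
    rewrite (add_omega_le_zero_or_limit _ (add_omega_zero_or_limit m)).
    rewrite <- add_nat_S.
    rewrite (add_nat_le_zero_or_limit _ _ (add_omega_zero_or_limit m)).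
    rewrite succ_le_add_omega by exact hk.
    replace i with (i - S n + S n) by lia.
    rewrite le_add_nat_le_add_nat; apply zero_or_limit_le_add_nat, hk.
- exists m; rewrite hy.
  rewrite (zero_or_limit_le_add_nat _ _ (add_omega_zero_or_limit _)).
  rewrite add_omega_le_zero_or_limit, add_nat_S by exact hm; reflexivity.
Qed.

End Brouwer.

Theorem theorem4p4 (X : brouwer) (beta : X) (P : Prop) :
  ord_decidable beta P <-> ord_decidable (roundup beta) P.
Proof.
destruct (zero_or_limit_add_nat beta) as (k & [|n] & hk & ->).
(* Without a finite part, [beta] is its own round-up. *)
- rewrite add_nat_0, roundup_zero_or_limit by exact hk; reflexivity.
- rewrite (add_nat_S k n), roundup_succ, <- add_nat_S.
  apply ord_decidable_roundup_add_nat, hk.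
Qed.
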